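(* Let $n>3$ be an odd integer and let $d$ be any integer. Then $$\left|(i^2+dj^2)\left(\frac{i^2+dj^2}{n}\right)\right|_{0\le i,j\le (n-1)/2}\equiv 0 \pmod n,$$ where $\left(\frac{\cdot}{n}\right)$ denotes the Jacobi symbol.
   Context: For a square matrix $[a_{ij}]_{0\le i,j\le m}$ over a commutative ring, $|a_{ij}|_{0\le i,j\le m}$ denotes its determinant. *)

(* Defs.v *)
From mathcomp Require Import all_boot all_order all_algebra.

Set Implicit Arguments.
Unset Strict Implicit.
Unset Printing Implicit Defensive.

Import GRing.Theory.

Local Open Scope ring_scope.

(* Meaningful for p an odd prime. *)
Definition legendre (a : int) (p : nat) : int :=
  if (p%:Z %| a)%Z then 0
  else if [exists x : 'I_p, (x%:Z ^+ 2 == a %[mod p%:Z])%Z] then 1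
  else -1.

(* Meaningful for n odd and positive; jacobi a 1 = 1 (empty product). *)
Definition jacobi (a : int) (n : nat) : int :=
  \prod_(p <- primes n) legendre a p ^+ logn p n.

(* Main.v *)
(** If [n = a * b] is composite, the distinct indices [(a + b) / 2] and
    [(b - a) / 2] have squares differing by [n], so two rows agree modulo [n].
    If [n = p > 3] is prime, put [m = (p + 1) / 2]: by Euler's criterion the
    entry at [(i, j)] is [(i^2 + d j^2)^m] modulo [p].  The binomial expansion
    has [m + 1] terms, but [i^(2 m) = i^2] lets the terms of index [0] and
    [m - 1], and likewise those of index [1] and [m], be merged; so the
    [m]-by-[m] matrix has rank at most [m - 1]. *)

Require Import Defs.
From mathcomp Require Import all_boot all_order all_algebra.
From mathcomp Require Import finfield ring zify.

Local Open Scope ring_scope.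

Import GRing.Theory.

Lemma legendre_congr (a b : int) (p : nat) :
  (a = b %[mod p%:Z])%Z -> legendre a p = legendre b p.
Proof.
move=> eq_ab; rewrite /legendre.
have -> : (p%:Z %| a)%Z = (p%:Z %| b)%Z.
  by apply/dvdz_mod0P/dvdz_mod0P; rewrite eq_ab.
by under eq_existsb => x do rewrite eq_ab.
Qed.

Lemma jacobi_congr (a b : int) (n : nat) :
  (a = b %[mod n%:Z])%Z -> jacobi a n = jacobi b n.
Proof.
move=> eq_ab; rewrite /jacobi; apply: eq_big_seq => p.
rewrite mem_primes => /and3P[_ _ p_n].
congr (_ ^+ _); apply: legendre_congr; apply/eqP.
rewrite eqz_mod_dvd; apply: (@dvdz_trans n%:Z) => //.
by rewrite -eqz_mod_dvd; apply/eqP.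
Qed.

(** Row [i1] is row [i2] plus [n] times an integral row. Multilinearity gives
    [\det A = \det B + n * \det C], where [B] has two equal rows. *)
Lemma dvdz_det_congr_rows (m : nat) (n : int) (A : 'M[int]_m) (i1 i2 : 'I_m) :
  i1 != i2 -> (forall j, A i1 j = A i2 j %[mod n])%Z -> (n %| \det A)%Z.
Proof.
move=> neq_i eqA.
pose B := \matrix_(i, j) (if i == i1 then A i2 j else A i j).
pose C := \matrix_(i, j)
  (if i == i1 then ((A i1 j - A i2 j) %/ n)%Z else A i j).
rewrite (@determinant_multilinear _ _ A B C i1 1 n).
- rewrite (@determinant_alternate _ _ B i1 i2) //; last first.
    by move=> j; rewrite !mxE eqxx eq_sym (negPf neq_i).
  by rewrite mulr0 add0r dvdz_mulr.
- apply/rowP=> j; rewrite !mxE eqxx mul1r mulrC divzK ?subrKC //.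
  by rewrite -eqz_mod_dvd; apply/eqP.
- by apply/matrixP=> i j; rewrite !mxE eq_sym (negPf (neq_lift _ _)).
- by apply/matrixP=> i j; rewrite !mxE eq_sym (negPf (neq_lift _ _)).
Qed.

(** By Fermat [x ^+ h] is 1 or -1. Were it 1, then [x] and the [h] squares of 1, ..., [h] would be
    [h + 1] distinct roots of ['X^h - 1]. *)
Lemma Fp_nonsquare_expr (p h : nat) (x : 'F_p) :
  prime p -> p = h.*2.+1 -> x != 0 -> (forall y, y ^+ 2 != x) -> x ^+ h = -1.
Proof.
move=> p_pr def_p x_nz x_nsq.
have h_gt0 : (0 < h)%N by case: h def_p p_pr => // ->.
have pcharp := pchar_Fp p_pr.
have fermat (y : 'F_p) : y != 0 -> (y ^+ 2) ^+ h = 1.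
  move=> y_nz; apply: (mulIf y_nz).
  rewrite -exprM mul2n -exprSr -def_p -[X in _ ^+ X](card_Fp p_pr).
  by rewrite expf_card mul1r.
have : (x ^+ h) ^+ 2 == 1 ^+ 2 by rewrite -exprM mulnC exprM fermat ?expr1n.
rewrite eqf_sqr => /orP[/eqP xh1 | /eqP //].
pose s : seq 'F_p := x :: [seq i.+1%:R ^+ 2 | i <- iota 0 h].
have small_nz k : (0 < k < p)%N -> (k%:R : 'F_p) != 0.
  by move=> /andP[k0 kp]; rewrite -(dvdn_pcharf pcharp) gtnNdvd.
have : (size s < size ('X^h - 1%:P : {poly 'F_p})%R)%N.
  apply: max_poly_roots.
  - by rewrite -size_poly_eq0 size_XnsubC.
  - apply/allP=> y; rewrite inE rootE !hornerE subr_eq0.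
    case/predU1P=> [-> | /mapP[i]]; first by rewrite xh1.
    by rewrite mem_iota => /andP[_ i_h] ->; rewrite fermat // small_nz //; lia.
  - rewrite /= map_inj_in_uniq ?iota_uniq ?andbT.
      by apply/mapP=> -[i _ def_x]; have := x_nsq i.+1%:R; rewrite def_x eqxx.
    (* For [i < j] the difference and the sum of [i.+1] and [j.+1] lie strictly between 0 and [p],
       so neither vanishes in ['F_p]. *)
    have main (i j : nat) : (i <= j < h)%N ->
        (i.+1%:R ^+ 2 : 'F_p) = j.+1%:R ^+ 2 -> i = j.
      move=> ij /eqP; rewrite eq_sym eqf_sqr -subr_eq0 -addr_eq0 -natrB; last by lia.
      rewrite -natrD.
      case/orP; last by rewrite (negPf (small_nz _ _)) //; lia.
      by case: (eqVneq i j) => // neq_ij; rewrite (negPf (small_nz _ _)) //; lia.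
    move=> i j; rewrite !mem_iota /= => i_h j_h eq_ij.
    have [le_ij | lt_ji] := leqP i j; first by apply: main => //; lia.
    by apply/esym/main => //; lia.
by rewrite size_XnsubC //= size_map size_iota ltnn.
Qed.

Lemma euler_criterion (p h : nat) (a : int) :
  prime p -> p = h.*2.+1 -> (legendre a p)%:~R = a%:~R ^+ h :> 'F_p.
Proof.
move=> p_pr def_p.
have h_gt0 : (0 < h)%N by case: h def_p p_pr => // ->.
have pcharp := pchar_Fp p_pr.
rewrite /legendre (dvdz_pcharf pcharp).
have [-> | a_nz] := eqVneq; first by rewrite expr0n gtn_eqF.
case: existsP => [[x] | a_nsq].
  rewrite eqz_mod_dvd (dvdz_pcharf pcharp) rmorphB rmorphXn /= subr_eq0.
  move/eqP=> def_a; rewrite -def_a in a_nz *.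
  rewrite expf_eq0 /= in a_nz; apply: (mulIf a_nz).
  rewrite -exprM mul2n -exprSr -def_p -[X in _ ^+ X](card_Fp p_pr).
  by rewrite expf_card mul1r.
rewrite (Fp_nonsquare_expr _ _ _ p_pr def_p a_nz) // => y; apply/eqP=> def_a.
(* The bound of the ordinal type ['F_p] is only provably equal to [p], so the root is rebuilt in
   ['I_p]. *)
have y_p : (y < p)%N by rewrite -[X in (_ < X)%N](card_Fp p_pr) card_ord.
case: a_nsq; exists (Ordinal y_p).
rewrite eqz_mod_dvd (dvdz_pcharf pcharp) rmorphB rmorphXn /= subr_eq0.
by rewrite -def_a -[X in _ == X ^+ 2]natr_Zp.
Qed.

(** Such a matrix factors through dimension [m], so its rank is below its size [m.+1]. *)
Lemma det_sum_outer (F : fieldType) (m : nat) (A : 'M[F]_m.+1)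
    (u v : nat -> 'I_m.+1 -> F) :
  (forall i j, A i j = \sum_(k < m) u k i * v k j) -> \det A = 0.
Proof.
move=> defA; apply/eqP; rewrite -[_ == 0]negbK -unitfE -unitmxE.
apply/negP => /mxrank_unit rankA.
have eqA : A = (\matrix_(i < m.+1, k < m) u k i) *m (\matrix_(k < m, j < m.+1) v k j).
  by apply/matrixP=> i j; rewrite defA !mxE; under [RHS]eq_bigr do rewrite !mxE.
have := leq_trans (mxrankM_maxl _ _) (rank_leq_col (\matrix_(i < m.+1, k < m) u k i)).
by move/(_ _ (\matrix_(k < m, j < m.+1) v k j)); rewrite -eqA rankA ltnn.
Qed.

Lemma det_binomial_power (F : fieldType) (t : nat) (d : F)
    (x y : 'I_t.+3 -> F) :
  (forall i, x i ^+ t.+3 = x i) -> (forall j, y j ^+ t.+3 = y j) ->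
  \det (\matrix_(i, j) (x i + d * y j) ^+ t.+3) = 0.
Proof.
move=> xE yE.
(* Index 0 merges the binomial terms 0 and [t.+2], with common factor [x i]; index 1 merges the
   terms 1 and [t.+3], with common factor [y j]. The other [t] terms stay as they are, so [t.+2]
   products remain. *)
pose u k i := match k with
  | 0 => x i
  | 1 => d ^+ t.+3 + t.+3%:R * d * x i ^+ t.+2
  | k'.+2 => x i ^+ (t.+1 - k') *+ 'C(t.+3, k'.+2)
  end.
pose v k j := match k with
  | 0 => 1 + t.+3%:R * (d * y j) ^+ t.+2
  | 1 => y j
  | k'.+2 => (d * y j) ^+ k'.+2
  end.
apply: (@det_sum_outer _ _ _ u v) => i j; rewrite mxE exprDn.
pose S := \sum_(k < t) u k.+2 i * v k.+2 j.
have -> : \sum_(k < t.+2) u k i * v k j =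
    x i * (1 + t.+3%:R * (d * y j) ^+ t.+2)
    + ((d ^+ t.+3 + t.+3%:R * d * x i ^+ t.+2) * y j + S).
  by rewrite !big_ord_recl.
rewrite 2!big_ord_recl 2!big_ord_recr /= /bump !add1n subn0 subnn subn1.
rewrite subSn // subnn bin0 bin1 binn binSn.
have -> : \sum_(k < t) x i ^+ (t.+3 - (1 + (1 + k))) * (d * y j) ^+ (1 + (1 + k))
    *+ 'C(t.+3, 1 + (1 + k)) = S.
  by apply: eq_bigr => k _; rewrite /u /v !add1n mulrnAl.
rewrite xE [(d * y j) ^+ t.+3]exprMn yE !expr0 !expr1.
rewrite -(mulr_natl (_ * (d * y j))) -(mulr_natl (x i * (d * y j) ^+ _)).
move: S (x i ^+ t.+2) ((d * y j) ^+ t.+2) (d ^+ t.+3) t.+3%:R => S a b e c.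
ring.
Qed.

Theorem theorem1p1 (n : nat) (d : int) (hn : (3 < n)%N) (hodd : odd n) :
  (\det (\matrix_(i < (n.-1)./2.+1, j < (n.-1)./2.+1)
           ((i%:Z ^+ 2 + d * j%:Z ^+ 2) * jacobi (i%:Z ^+ 2 + d * j%:Z ^+ 2) n))
   = 0 %[mod n%:Z])%Z.
Proof.
apply/eqP; rewrite eqz_mod_dvd subr0.
have [n_pr | /primePns[|[a [/prime_gt1 a_gt1 le_a2n /dvdnP[b def_n]]]]] :=
  boolP (prime n); last 2 first.
- by lia.
- have /andP[odd_b odd_a] : odd b && odd a by rewrite -oddM -def_n.
  have le_ab : (a <= b)%N by nia.
  have [i def_b] : exists i, b = (a + i.*2)%N by exists (b - a)./2; lia.
  (* The rows are [a + i = (a + b) / 2] and [i = (b - a) / 2]. They are in range because [a] and [b]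
     are odd and at least 3, and their squares differ by [a * (a + i.*2) = n]. *)
  have i1P : (a + i < n.-1./2.+1)%N by nia.
  have i2P : (i < n.-1./2.+1)%N by nia.
  apply: (@dvdz_det_congr_rows _ _ _ (Ordinal i1P) (Ordinal i2P)).
    by rewrite -val_eqE /=; lia.
  move=> j; rewrite !mxE /=.
  have eq_q : ((a + i)%N%:Z ^+ 2 + d * j%:Z ^+ 2
               = i%:Z ^+ 2 + d * j%:Z ^+ 2 %[mod n%:Z])%Z.
    apply/eqP; rewrite eqz_mod_dvd; apply/dvdzP; exists 1.
    have -> : n%:Z = (a + i.*2)%N%:Z * a%:Z by rewrite -PoszM -def_b -def_n.
    by rewrite -muln2 !PoszD PoszM; ring.
  by rewrite (jacobi_congr _ _ _ eq_q) -modzMml eq_q modzMml.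
have pcharn := pchar_Fp n_pr.
rewrite (dvdz_pcharf pcharn) -det_map_mx.
(* A prime [n > 3] is at least 5, so the size [(n + 1) / 2] has the form [t.+3], and the Euler
   exponent [(n - 1) / 2] is [t.+2]. *)
have [t def_n] : exists t, n = t.+2.*2.+1 by exists (n - 5)./2; lia.
have def_m : n.-1./2.+1 = t.+3 by lia.
have eq_sqr (k : nat) : (k%:R ^+ 2) ^+ t.+3 = k%:R ^+ 2 :> 'F_n.
  rewrite -exprM (_ : (2 * t.+3 = n.+1)%N); last by lia.
  by rewrite exprS -[X in _ ^+ X](card_Fp n_pr) expf_card expr2.
rewrite def_m.
pose x (k : 'I_t.+3) : 'F_n := k%:R ^+ 2.
rewrite (_ : map_mx _ _ = \matrix_(i, j) (x i + d%:~R * x j) ^+ t.+3).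
  by apply/eqP/det_binomial_power => k; apply: eq_sqr.
apply/matrixP=> i j; rewrite !mxE rmorphM /= /jacobi primes_prime // big_seq1.
(* The factor in front of the Legendre symbol raises the exponent from [t.+2] to [t.+3]. *)
rewrite logn_prime // eqxx expr1 (euler_criterion _ _ _ n_pr def_n) -exprS.
by rewrite rmorphD rmorphM !rmorphXn.
Qed.
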